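(* Let $D=(\Pi,\mathcal{C})$ be a well-defined domain description over a finite non-empty action alphabet $\Sigma$. Then: (1) Given a temporal answer set $(\sigma,S)$ of $\Pi$ such that $\sigma$ can be finitely represented as a finite path with a $k$-loop, i.e. $\sigma=a_1a_2\dots a_j\,a_{j+1}\dots a_{k+1}\,a_{j+1}\dots a_{k+1}\dots$ for some $0\le j\le k$, there is a consistent answer set $R$ of $tr(\Pi)$ (with bound $k$) such that $R$ and $S$ correspond to the same temporal model, i.e. $M_R=M_S$. (2) Given a consistent answer set $R$ of $tr(\Pi)$, there is a temporal answer set $(\sigma,S)$ of $\Pi$ (that can be finitely represented as a finite path with a back loop) such that $R$ and $S$ correspond to the same temporal model, i.e. $M_R=M_S$.
   Context: **Literals and laws.** $\Sigma$ is a finite non-empty set of actions, $\mathcal{P}$ a set of fluent names. A simple literal is $f$ or $\neg f$ with $f\in\mathcal{P}$. Temporal literals are $[a]l$ (with $a\in\Sigma$) and $\bigcirc l$, with $l$ a simple literal; in heads $l$ may also be $\bot$. ''$not$'' is default negation. A domain description over $\Sigma$ is a pair $D=(\Pi,\mathcal{C})$, where $\mathcal{C}$ is a set of temporal (DLTL) constraints (irrelevant for this statement) and $\Pi$ is a set of laws (rules) of the following forms, where $l_0$ is a simple literal or $\bot$: - action laws $\Box([a]l_0\leftarrow t_1,\dots,t_m,not\,t_{m+1},\dots,not\,t_n)$, each $t_i$ being a simple literal or of the form $[a]l$ (same $a$); those with $l_0=\bot$ and simple literals in the body are called precondition laws; - static causal laws $\Box(l_0\leftarrow l_1,\dots,l_m,not\,l_{m+1},\dots,not\,l_n)$,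 all $l_i$ ($i\ge1$) simple; - dynamic causal laws $\Box(\bigcirc l_0\leftarrow t_1,\dots,t_m,not\,t_{m+1},\dots,not\,t_n)$, each $t_i$ simple or of the form $\bigcirc l$; - initial state laws $l_0\leftarrow l_1,\dots,l_m,not\,l_{m+1},\dots,not\,l_n$ (no $\Box$), all $l_i$ ($i\ge 1$) simple. It is assumed that for each fluent $f$, $\Pi$ contains the initial state laws $f\leftarrow not\,\neg f$ and $\neg f\leftarrow not\,f$. **Temporal answer sets.** Let $\sigma\in\Sigma^\omega$. A partial temporal interpretation over $\sigma$ is a pair $(\sigma,S)$ where $S$ is a set of expressions $[a_1;\dots;a_k]l$ with $a_1\dots a_k$ a finite (possibly empty) prefix of $\sigma$ and $l$ a simple literal, such that $S$ never contains both $[a_1;\dots;a_k]f$ and $[a_1;\dots;a_k]\neg f$, nor $[a_1;\dots;a_k]\bot$. It is total if for every finite prefix $a_1\dots a_k$ of $\sigma$ and every $p\in\mathcal{P}$, $[a_1;\dots;a_k]p\in S$ or $[a_1;\dots;a_k]\neg p\in S$. Satisfaction at a prefix $\tau=a_1\dots a_k$ of $\sigma$: $(\sigma,S),\tau\not\models\bot$; $(\sigma,S),\tau\models l$ iff $[a_1;\dots;a_k]l\in S$ ($l$ simple); $(\sigma,S),\tau\models[a]l$ iff $[a_1;\dots;a_k;a]l\in S$ or $\tau a$ is not a prefix of $\sigma$; $(\sigma,S),\tau\models\bigcirc l$ iff $[a_1;\dots;a_k;b]l\in S$, where $\tau b$ is the prefix of $\sigma$ of length $k+1$; $(\sigma,S),\tau\models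 not\,t$ iff $(\sigma,S),\tau\not\models t$. A body is satisfied iff all its elements are. A rule $H\leftarrow B$ is satisfied in $(\sigma,S)$ if satisfaction of $B$ at the empty prefix $\varepsilon$ implies satisfaction of $H$ at $\varepsilon$; $\Box(H\leftarrow B)$ is satisfied if this implication holds at every finite prefix of $\sigma$; $[a_1;\dots;a_h](H\leftarrow B)$ is satisfied if the implication holds at the prefix $a_1\dots a_h$. For a set $P$ of rules without default negation, $(\sigma,S)$ is a temporal answer set of $P$ if $S$ is $\subseteq$-minimal among the $S'$ such that $(\sigma,S')$ is a partial temporal interpretation satisfying the rules in $P$. For general $P$, the reduct $P^{(\sigma,S)}$ is the set of all rules $[a_1;\dots;a_h](H\leftarrow t_1,\dots,t_m)$ such that $a_1\dots a_h$ is a finite prefix of $\sigma$, $\Box(H\leftarrow t_1,\dots,t_m,not\,t_{m+1},\dots,not\,t_n)\in P$ and $(\sigma,S),a_1\dots a_h\not\models t_i$ for all $i=m+1,\dots,n$, together with, for each initial state law $H\leftarrow t_1,\dots,t_m,not\,t_{m+1},\dots,not\,t_n$ in $P$ with $(\sigma,S),\varepsilon\not\models t_i$ for $i=m+1,\dots,n$, the rule $H\leftarrow t_1,\dots,t_m$. $(\sigma,S)$ is a temporal answer set of $P$ if it is a temporal answer set of $P^{(\sigma,S)}$. $D=(\Pi,\mathcal{C})$ is well-defined if the temporal answer sets of $\Pi$ are total. **Temporal models.** A temporal model is a pair $(\sigma,V)$ with $\sigma\in\Sigma^\omega$ and $V$ mapping each finite prefix of $\sigma$ to a subset of $\mathcal{P}$.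 A total temporal answer set $(\sigma,S)$ corresponds to $M_S=(\sigma,V_S)$ with $p\in V_S(a_1\dots a_h)$ iff $[a_1;\dots;a_h]p\in S$. **Translation $tr(\Pi)$.** A bound $k\ge0$ on the number of states is assumed. $tr(\Pi)$ is the following (grounded) standard answer set program with classical negation $\neg$ and default negation $not$. States are the integers $0,\dots,k+1$ (predicate $state$); $action$ and $fluent$ are given by facts. For a simple literal $l=(\neg)f$, write $(\neg)holds(f,S)$ for its translation at $S$. The rules are: - for $S\in\{0,\dots,k\}$: $\neg occurs(A,S)\leftarrow occurs(A_1,S)$ for all actions $A\ne A_1$; and $occurs(A,S)\leftarrow not\,\neg occurs(A,S)$ for all actions $A$; - for each action law with head $[a](\neg)f_0$ and each $S\in\{0,\dots,k\}$: $(\neg)holds(f_0,S+1)\leftarrow occurs(a,S),h_1,\dots,h_m,not\,h_{m+1},\dots,not\,h_n$, where $h_i=(\neg)holds(f_i,S+1)$ if $t_i=[a](\neg)f_i$ and $h_i=(\neg)holds(f_i,S)$ if $t_i=(\neg)f_i$; - for each dynamic causal law with head $\bigcirc(\neg)f_0$ and each $S\in\{0,\dots,k\}$: $(\neg)holds(f_0,S+1)\leftarrow h_1,\dots,h_m,not\,h_{m+1},\dots,not\,h_n$, where $h_i=(\neg)holds(f_i,S+1)$ if $t_i=\bigcirc(\neg)f_i$ and $h_i=(\neg)holds(f_i,S)$ if $t_i=(\neg)f_i$; - static causal laws: the analogous rule with head and body all at state $S$, for each $S\in\{0,\dots,k+1\}$; initial state laws: the analogous rule at state $0$ only; - laws whose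 head literal is $\bot$ are translated in the same way to constraints (rules with empty head); - loop rules: $\mathit{diff\_last}(S)\leftarrow holds(F,S),\neg holds(F,k+1)$ and $\mathit{diff\_last}(S)\leftarrow holds(F,k+1),\neg holds(F,S)$ and $\mathit{eq\_last}(S)\leftarrow not\,\mathit{diff\_last}(S)$, for $0\le S\le k$ and fluents $F$; $next(S,S+1)$ for $0\le S<k$; $\neg next(k,S)\leftarrow next(k,S')$ for all states $S\neq S'$; $next(k,S)\leftarrow not\,\neg next(k,S)$ for $0\le S\le k$; and the constraint $\leftarrow next(k,S),not\,\mathit{eq\_last}(S)$. **Temporal model of an answer set $R$ of $tr(\Pi)$.** If $occurs(a_1,0),\dots,occurs(a_{k+1},k)$ and $next(k,j)$ belong to $R$, then $M_R=(\sigma_R,V_R)$ with $\sigma_R=a_1\dots a_j\,a_{j+1}\dots a_{k+1}\,a_{j+1}\dots a_{k+1}\dots$, and for $p\in\mathcal{P}$: $p\in V_R(\varepsilon)$ iff $holds(p,0)\in R$; $p\in V_R(a_1\dots a_h)$ iff $holds(p,h)\in R$ for $0<h\le k$; $p\in V_R(a_1\dots a_{k+1})$ iff $holds(p,j)\in R$; and so on periodically around the loop $j,\dots,k$.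
   Formalization: In (1) the valuation of the temporal model, not only the action word σ, is required to follow the k-loop; in (2) R is assumed to decide every fluent at each of the states 0,…,k+1. Without these assumptions both parts are false. *)

(* Defs.v *)
(* MathComp world, with the classical sets of MathComp-Analysis. *)
From mathcomp Require Import all_boot.
From mathcomp Require Import boolp classical_sets.
From Stdlib Require List.

Set Implicit Arguments.
Unset Strict Implicit.
Unset Printing Implicit Defensive.

Local Open Scope classical_set_scope.

Inductive literal (A : Type) : Type :=
  | Pos of A
  | Neg of A.

Section Laws.
Variables (Sigma P : Type).

(* A body element t_i of a law with head [a]l0 or (next)l0, relative to that
   head: [Cur l] is the simple literal l, evaluated in the current state, and
   [Suc l] is [a]l (with the same a as the head) or (next)l. *)
Inductive step_literal : Type :=
  | Cur of literal P
  | Suc of literal P.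

(* Heads have type [option (literal P)]; [None] is falsity.  The last two
   arguments of each constructor are the positive body t_1, ..., t_m and the
   default-negated body t_(m+1), ..., t_n. *)
Inductive law : Type :=
  | ActionLaw of Sigma & option (literal P) &
                 seq step_literal & seq step_literal
  | StaticLaw of option (literal P) & seq (literal P) & seq (literal P)
  | DynamicLaw of option (literal P) & seq step_literal & seq step_literal
  | InitialLaw of option (literal P) & seq (literal P) & seq (literal P).

(* f <- not ~f and ~f <- not f, for every fluent f. *)
Definition initially_completed (Pi : set law) : Prop :=
  forall f : P,
    Pi (InitialLaw (Some (Pos f)) [::] [:: Neg f]) /\
    Pi (InitialLaw (Some (Neg f)) [::] [:: Pos f]).

End Laws.

Section TemporalAnswerSets.
Variables (Sigma P : Type).
Implicit Types (sigma : nat -> Sigma) (w : seq Sigma).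

(* The infinite word a_1 a_2 a_3 ... is the function sigma with
   sigma i = a_(i+1). *)
Definition prefix_of sigma n : seq Sigma := mkseq sigma n.

Definition is_prefix sigma w : Prop := w = prefix_of sigma (size w).

(* ([:: a_1; ...; a_k], l) is the expression [a_1; ...; a_k]l.  As l is a
   simple literal, [a_1; ...; a_k]falsity is excluded by typing. *)
Definition expression : Type := (seq Sigma * literal P)%type.

Definition partial_interpretation sigma (S : set expression) : Prop :=
  (forall w l, S (w, l) -> is_prefix sigma w) /\
  (forall w f, ~ (S (w, Pos f) /\ S (w, Neg f))).

Definition total sigma (S : set expression) : Prop :=
  forall n f, S (prefix_of sigma n, Pos f) \/ S (prefix_of sigma n, Neg f).

Inductive temporal_literal : Type :=
  | Now of option (literal P)
  | After of Sigma & option (literal P)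
  | Next of option (literal P).

Definition mem_expression (S : set expression) w (l : option (literal P)) :
    Prop :=
  if l is Some l' then S (w, l') else False.

Definition sat sigma (S : set expression) w (t : temporal_literal) : Prop :=
  match t with
  | Now l => mem_expression S w l
  | After a l =>
      mem_expression S (rcons w a) l \/ ~ is_prefix sigma (rcons w a)
  | Next l => mem_expression S (rcons w (sigma (size w))) l
  end.

Definition now (l : literal P) : temporal_literal := Now (Some l).

Definition after (a : Sigma) (t : step_literal P) : temporal_literal :=
  match t with Cur l => now l | Suc l => After a (Some l) end.

Definition next (t : step_literal P) : temporal_literal :=
  match t with Cur l => now l | Suc l => Next (Some l) end.

Definition law_head (r : law Sigma P) : temporal_literal :=
  match r with
  | ActionLaw a l0 _ _ => After a l0
  | StaticLaw l0 _ _ => Now l0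
  | DynamicLaw l0 _ _ => Next l0
  | InitialLaw l0 _ _ => Now l0
  end.

Definition law_pos (r : law Sigma P) : seq temporal_literal :=
  match r with
  | ActionLaw a _ pos _ => map (after a) pos
  | StaticLaw _ pos _ => map now pos
  | DynamicLaw _ pos _ => map next pos
  | InitialLaw _ pos _ => map now pos
  end.

Definition law_neg (r : law Sigma P) : seq temporal_literal :=
  match r with
  | ActionLaw a _ _ neg => map (after a) neg
  | StaticLaw _ _ neg => map now neg
  | DynamicLaw _ _ neg => map next neg
  | InitialLaw _ _ neg => map now neg
  end.

Definition boxed (r : law Sigma P) : Prop :=
  if r is InitialLaw _ _ _ then False else True.

(* [a_1; ...; a_h](H <- t_1, ..., t_m), without default negation; the context
   is empty for the rule obtained from an initial state law. *)
Record positive_rule : Type := PositiveRule {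
  rule_context : seq Sigma;
  rule_head : temporal_literal;
  rule_body : seq temporal_literal }.

Definition sat_rule sigma (S : set expression) (r : positive_rule) : Prop :=
  (forall t, List.In t (rule_body r) -> sat sigma S (rule_context r) t) ->
  sat sigma S (rule_context r) (rule_head r).

Definition positive_model (Q : set positive_rule) sigma (S : set expression) :
    Prop :=
  partial_interpretation sigma S /\ forall r, Q r -> sat_rule sigma S r.

Definition positive_answer_set (Q : set positive_rule) sigma
    (S : set expression) : Prop :=
  positive_model Q sigma S /\
  forall S', positive_model Q sigma S' -> S' `<=` S -> S' = S.

Definition reduct (Pi : set (law Sigma P)) sigma (S : set expression) :
    set positive_rule :=
  [set q | exists (r : law Sigma P) (h : nat),
     [/\ Pi r,
         boxed r \/ h = 0,
         (forall t, List.In t (law_neg r) -> ~ sat sigma S (prefix_of sigma h) t)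
       & q = PositiveRule (prefix_of sigma h) (law_head r) (law_pos r)]].

Definition temporal_answer_set (Pi : set (law Sigma P)) sigma
    (S : set expression) : Prop :=
  positive_answer_set (reduct Pi sigma S) sigma S.

Definition well_defined (Pi : set (law Sigma P)) : Prop :=
  forall sigma S, temporal_answer_set Pi sigma S -> total sigma S.

(* The valuation is indexed by the lengths of the prefixes of the path. *)
Record temporal_model : Type := TemporalModel {
  path : nat -> Sigma;
  valuation : nat -> set P }.

Definition model_of_interpretation sigma (S : set expression) :
    temporal_model :=
  TemporalModel sigma (fun h => [set p | S (prefix_of sigma h, Pos p)]).

End TemporalAnswerSets.

(* The position, among 0, ..., k, reached after h steps along a path whose
   position k is followed by position j (for j <= k). *)
Definition loop_position (j k h : nat) : nat :=
  if h < j then h else j + (h - j) %% (k.+1 - j).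

Section Loops.
Variables (Sigma P : Type).

(* sigma = a_1 ... a_j a_(j+1) ... a_(k+1) a_(j+1) ... a_(k+1) ... *)
Definition path_with_loop (j k : nat) (sigma : nat -> Sigma) : Prop :=
  forall h, sigma h = sigma (loop_position j k h).

Definition valuation_with_loop (j k : nat) (V : nat -> set P) : Prop :=
  forall h, V h = V (loop_position j k h).

(* The model is represented by its first k+1 states and actions, with the
   action at state k leading back to state j: both components loop. *)
Definition model_with_loop (j k : nat) (M : temporal_model Sigma P) : Prop :=
  path_with_loop j k (path M) /\ valuation_with_loop j k (valuation M).

End Loops.

Section AnswerSets.
Variable A : Type.
Implicit Type X : set (literal A).

(* The head [None] is the empty head of a constraint. *)
Record asp_rule : Type := AspRule {
  asp_head : option (literal A);
  asp_pos : seq (literal A);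
  asp_neg : seq (literal A) }.

Definition asp_fact (l : literal A) : asp_rule := AspRule (Some l) [::] [::].

Definition consistent X : Prop := forall a, ~ (X (Pos a) /\ X (Neg a)).

Definition asp_reduct (Q : set asp_rule) X : set asp_rule :=
  [set q | exists r,
     [/\ Q r,
         (forall l, List.In l (asp_neg r) -> ~ X l)
       & q = AspRule (asp_head r) (asp_pos r) [::]]].

(* For programs without default negation.  A set containing complementary
   literals has to be the set of all literals. *)
Definition asp_closed (Q : set asp_rule) X : Prop :=
  (forall r, Q r -> (forall l, List.In l (asp_pos r) -> X l) ->
     if asp_head r is Some l then X l else False) /\
  (consistent X \/ X = setT).

Definition asp_answer_set (Q : set asp_rule) X : Prop :=
  asp_closed (asp_reduct Q X) X /\
  forall X', asp_closed (asp_reduct Q X) X' -> X' `<=` X -> X' = X.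

End AnswerSets.

Section Translation.
Variables (Sigma P : Type).

Inductive asp_atom : Type :=
  | State of nat
  | Action of Sigma
  | Fluent of P
  | Holds of P & nat
  | Occurs of Sigma & nat
  | NextState of nat & nat
  | DiffLast of nat
  | EqLast of nat.

Definition holds_at (s : nat) (l : literal P) : literal asp_atom :=
  match l with
  | Pos f => Pos (Holds f s)
  | Neg f => Neg (Holds f s)
  end.

Definition step_at (s : nat) (t : step_literal P) : literal asp_atom :=
  match t with
  | Cur l => holds_at s l
  | Suc l => holds_at s.+1 l
  end.

Inductive tr (k : nat) (Pi : set (law Sigma P)) : set (asp_rule asp_atom) :=
  | tr_state s : s <= k.+1 -> tr k Pi (asp_fact (Pos (State s)))
  | tr_action a : tr k Pi (asp_fact (Pos (Action a)))
  | tr_fluent f : tr k Pi (asp_fact (Pos (Fluent f)))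
  | tr_not_occurs a a1 s : s <= k -> a <> a1 ->
      tr k Pi (AspRule (Some (Neg (Occurs a s))) [:: Pos (Occurs a1 s)] [::])
  | tr_occurs a s : s <= k ->
      tr k Pi (AspRule (Some (Pos (Occurs a s))) [::] [:: Neg (Occurs a s)])
  | tr_action_law a l0 pos neg s : Pi (ActionLaw a l0 pos neg) -> s <= k ->
      tr k Pi (AspRule (omap (holds_at s.+1) l0)
                 (Pos (Occurs a s) :: map (step_at s) pos)
                 (map (step_at s) neg))
  | tr_dynamic_law l0 pos neg s : Pi (DynamicLaw _ l0 pos neg) -> s <= k ->
      tr k Pi (AspRule (omap (holds_at s.+1) l0)
                 (map (step_at s) pos) (map (step_at s) neg))
  | tr_static_law l0 pos neg s : Pi (StaticLaw _ l0 pos neg) -> s <= k.+1 ->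
      tr k Pi (AspRule (omap (holds_at s) l0)
                 (map (holds_at s) pos) (map (holds_at s) neg))
  | tr_initial_law l0 pos neg : Pi (InitialLaw _ l0 pos neg) ->
      tr k Pi (AspRule (omap (holds_at 0) l0)
                 (map (holds_at 0) pos) (map (holds_at 0) neg))
  | tr_diff_last_pos f s : s <= k ->
      tr k Pi (AspRule (Some (Pos (DiffLast s)))
                 [:: Pos (Holds f s); Neg (Holds f k.+1)] [::])
  | tr_diff_last_neg f s : s <= k ->
      tr k Pi (AspRule (Some (Pos (DiffLast s)))
                 [:: Pos (Holds f k.+1); Neg (Holds f s)] [::])
  | tr_eq_last s : s <= k ->
      tr k Pi (AspRule (Some (Pos (EqLast s))) [::] [:: Pos (DiffLast s)])
  | tr_next s : s < k -> tr k Pi (asp_fact (Pos (NextState s s.+1)))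
  | tr_not_next_last s s' : s <= k.+1 -> s' <= k.+1 -> s <> s' ->
      tr k Pi (AspRule (Some (Neg (NextState k s))) [:: Pos (NextState k s')] [::])
  | tr_next_last s : s <= k ->
      tr k Pi (AspRule (Some (Pos (NextState k s))) [::] [:: Neg (NextState k s)])
  | tr_loop s : s <= k.+1 ->
      tr k Pi (AspRule None [:: Pos (NextState k s)] [:: Pos (EqLast s)]).

(* M_R, for R containing next(k, j) and occurs(a i, i) for i = 0, ..., k. *)
Definition model_of_answer_set (k j : nat) (a : nat -> Sigma)
    (R : set (literal asp_atom)) : temporal_model Sigma P :=
  TemporalModel (fun h => a (loop_position j k h))
    (fun h => [set p | R (Pos (Holds p (loop_position j k h)))]).

(* M is the temporal model M_R of R. *)
Definition is_model_of_answer_set (k : nat) (R : set (literal asp_atom))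
    (M : temporal_model Sigma P) : Prop :=
  exists (j : nat) (a : nat -> Sigma),
    [/\ j <= k,
        R (Pos (NextState k j)),
        (forall i, i <= k -> R (Pos (Occurs (a i) i)))
      & M = model_of_answer_set k j a R].

(* The counterpart of [total] for the states 0, ..., k+1 of the program.  It
   does not follow from [well_defined]: a partial state k+1 of an answer set
   may have no infinite continuation, and the rules for [DiffLast] only detect
   fluents with opposite values, not fluents undefined in one of the states. *)
Definition state_total (k : nat) (R : set (literal asp_atom)) : Prop :=
  forall p s, s <= k.+1 -> R (Pos (Holds p s)) \/ R (Neg (Holds p s)).

End Translation.

(* Main.v *)
(* In both semantics minimality is a property of one state at a time.  Shrinking
   a single state of a closed set can only falsify bodies in the next state, so
   an answer set is a closed set in which each state is minimal relative to its
   predecessor and to the action between them ([state_stable]).  A temporal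
   answer set is thus a path whose transitions are all stable, and an answer set
   of the program is a stable path of length k+1 whose last state agrees with
   the state j chosen by next(k,j).  Going around the loop turns the latter into
   the former, and cutting off after k+1 steps does the converse. *)
Require Import Defs.
From mathcomp Require Import all_boot.
From mathcomp Require Import boolp classical_sets.

Set Implicit Arguments.
Unset Strict Implicit.
Unset Printing Implicit Defensive.

(** * Firing of rule bodies *)

Lemma In_map_all (A B : Type) (f : A -> B) (Q : B -> Prop) (s : seq A) :
  (forall t, List.In t (map f s) -> Q t) <->
  (forall t, List.In t s -> Q (f t)).
Proof.
elim: s => [|x s [IH1 IH2]]; first by split.
split=> H t /= [].
- by move=> <-; apply: H; left.
- by apply: IH1 => u Hu; apply: H; right.
- by move=> <-; apply: H; left.
- by apply: IH2 => u Hu; apply: H; right.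
Qed.

(** Default negation is read in [N], the set that defines the reduct, and the positive body in [X],
    the candidate model. Closure under a reduct can then be expressed directly on the original
    laws. *)
Definition fires (A : Type) (N X : A -> Prop) (pos neg : seq A) : Prop :=
  (forall t, List.In t pos -> X t) /\ (forall t, List.In t neg -> ~ N t).

Lemma fires_map (A B : Type) (f : A -> B) (N X : B -> Prop) (pos neg : seq A) :
  fires N X (map f pos) (map f neg) <->
  fires (fun t => N (f t)) (fun t => X (f t)) pos neg.
Proof.
by split=> -[/In_map_all Hp /(In_map_all f (fun t => ~ N t)) Hn]; split=> //;
  apply/In_map_all.
Qed.

Lemma fires_mono (A : Type) (N N' X X' : A -> Prop) (pos neg : seq A) :
  (forall t, N' t -> N t) -> (forall t, X t -> X' t) ->
  fires N X pos neg -> fires N' X' pos neg.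
Proof.
move=> NN XX [Hp Hn]; split=> t Ht; first exact/XX/Hp.
by move=> /NN; apply: Hn.
Qed.

Definition head_in (A : Type) (X : set A) (l0 : option A) : Prop :=
  if l0 is Some l then X l else False.

(** * Closure and stability of a single state *)

Section LocalStability.
Variables (Sigma P : Type) (Pi : set (law Sigma P)).
Implicit Types (N X Y : set (literal P)) (T : nat -> set (literal P)).

Definition step_sat X Y (t : step_literal P) : Prop :=
  match t with Cur l => X l | Suc l => Y l end.

Definition initial_closed N Y : Prop :=
  forall l0 pos neg, Pi (InitialLaw _ l0 pos neg) ->
    fires N Y pos neg -> head_in Y l0.

Definition static_closed N Y : Prop :=
  forall l0 pos neg, Pi (StaticLaw _ l0 pos neg) ->
    fires N Y pos neg -> head_in Y l0.

(** Along a transition by [a], an action law for [a] and a dynamic law say the same thing, so both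
    are treated at once. [N0] and [N] are the old and the new state in which default negation is
    read. *)
Definition step_closed (a : Sigma) N0 N X Y : Prop :=
  forall l0 pos neg,
    Pi (ActionLaw a l0 pos neg) \/ Pi (DynamicLaw _ l0 pos neg) ->
    fires (step_sat N0 N) (step_sat X Y) pos neg -> head_in Y l0.

(** The predecessor [X] occurs only in positive bodies, default negation being frozen in [N0]. This
    monotonicity is what makes minimality local. *)
Lemma step_closed_anti a N0 N X X' Y :
  (X' `<=` X)%classic -> step_closed a N0 N X Y -> step_closed a N0 N X' Y.
Proof.
move=> XX clo l0 pos neg Hr Hf; apply: clo Hr _.
by apply: fires_mono Hf => // -[] l //=; apply: XX.
Qed.

(* [pre] is [None] for the initial state, and [Some (a, X)] for a state reached
   from the state [X] by the action [a]. *)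
Definition state_closed (pre : option (Sigma * set (literal P))) N Y : Prop :=
  static_closed N Y /\
  match pre with
  | None => initial_closed N Y
  | Some (a, X) => step_closed a X N X Y
  end.

Definition state_stable (pre : option (Sigma * set (literal P))) X : Prop :=
  state_closed pre X X /\
  forall Y, (Y `<=` X)%classic -> state_closed pre X Y -> (X `<=` Y)%classic.

Definition predecessor (sigma : nat -> Sigma) T (h : nat) :=
  if h is h'.+1 then Some (sigma h', T h') else None.

(** * Temporal answer sets are the stable paths *)

Section Temporal.
Variable sigma : nat -> Sigma.
Implicit Types S : set (expression Sigma P).

Definition state_at S h : set (literal P) :=
  [set l | S (prefix_of sigma h, l)]%classic.

Lemma size_prefix_of h : size (prefix_of sigma h) = h.
Proof. by rewrite size_mkseq. Qed.

Lemma is_prefix_prefix_of h : is_prefix sigma (prefix_of sigma h).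
Proof. by rewrite /is_prefix size_prefix_of. Qed.

Lemma prefix_ofS h : rcons (prefix_of sigma h) (sigma h) = prefix_of sigma h.+1.
Proof. by rewrite /prefix_of mkseqS. Qed.

Lemma is_prefix_rcons h a :
  is_prefix sigma (rcons (prefix_of sigma h) a) <-> a = sigma h.
Proof.
rewrite /is_prefix size_rcons size_prefix_of -prefix_ofS; split=> [|-> //].
by move/rcons_inj => [].
Qed.

Lemma sat_after S h t :
  sat sigma S (prefix_of sigma h) (after (sigma h) t) <->
  step_sat (state_at S h) (state_at S h.+1) t.
Proof.
case: t => l //=; rewrite prefix_ofS; split=> [[//|[]]|]; last by left.
exact: is_prefix_prefix_of.
Qed.

Lemma sat_next S h t :
  sat sigma S (prefix_of sigma h) (Defs.next Sigma t) <->
  step_sat (state_at S h) (state_at S h.+1) t.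
Proof. by case: t => l //=; rewrite size_prefix_of prefix_ofS. Qed.

Lemma mem_expression_head_in S h l0 :
  mem_expression S (prefix_of sigma h) l0 <-> head_in (state_at S h) l0.
Proof. by case: l0. Qed.

(** The rules of the reduct are regrouped by the state that their head constrains: a step law in
    context [h] counts for state [h.+1]. Action laws for an action off the path hold vacuously. *)
Lemma sat_reductP S S' :
  (forall q, reduct Pi sigma S q -> sat_rule sigma S' q) <->
  (forall h, static_closed (state_at S h) (state_at S' h) /\
     match h with
     | 0 => initial_closed (state_at S h) (state_at S' h)
     | h'.+1 => step_closed (sigma h') (state_at S h') (state_at S h)
                  (state_at S' h') (state_at S' h)
     end).
Proof.
(* The instance of [r] at the prefix of length [h] belongs to the reduct exactly because the
   default-negated part of [fires] holds. *)
have use (r : law Sigma P) h : Pi r -> boxed r \/ h = 0 ->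
    (forall q, reduct Pi sigma S q -> sat_rule sigma S' q) ->
    fires (sat sigma S (prefix_of sigma h)) (sat sigma S' (prefix_of sigma h))
      (law_pos r) (law_neg r) ->
    sat sigma S' (prefix_of sigma h) (law_head r).
  move=> Pr br H [Hp Hn].
  by apply: (H (PositiveRule _ _ _)) Hp; exists r, h.
split=> [H h | H q [r] [h] [Pr br Hn ->] Hp].
- split.
  + move=> l0 pos neg Hr Hf; apply/mem_expression_head_in.
    by apply: (use _ h Hr _ H); [left | apply/fires_map].
  + case: h => [|h] l0 pos neg.
      move=> Hr Hf; apply/mem_expression_head_in.
      by apply: (use _ 0 Hr _ H); [right | apply/fires_map].
    case=> Hr Hf; apply/mem_expression_head_in.
      have := use _ h Hr (or_introl I) H; rewrite /= prefix_ofS => -[].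
      * by apply/fires_map/(fires_mono _ _ Hf) => t /sat_after.
      * by [].
      * by case; apply: is_prefix_prefix_of.
    have := use _ h Hr (or_introl I) H.
    rewrite /= size_prefix_of prefix_ofS; apply.
    by apply/fires_map/(fires_mono _ _ Hf) => t /sat_next.
- have {Hp Hn} : fires (sat sigma S (prefix_of sigma h))
    (sat sigma S' (prefix_of sigma h)) (law_pos r) (law_neg r) by [].
  case: r Pr br => [a||| ] l0 pos neg Pr br /= Hf.
  + case: (pselect (a = sigma h)) => [ea|na]; last by right=> /is_prefix_rcons.
    left; rewrite ea in Pr Hf *; rewrite prefix_ofS.
    apply/mem_expression_head_in.
    apply: (H h.+1).2 (or_introl Pr) _.
    by move/fires_map: Hf; apply: fires_mono => t /sat_after.
  + apply/mem_expression_head_in; apply: (H h).1 Pr _.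
    by move/fires_map: Hf; apply: fires_mono.
  + rewrite size_prefix_of prefix_ofS; apply/mem_expression_head_in.
    apply: (H h.+1).2 (or_intror Pr) _.
    by move/fires_map: Hf; apply: fires_mono => t /sat_next.
  + apply/mem_expression_head_in; case: br => // h0; rewrite h0 in Hf *.
    by apply: (H 0).2 Pr _; move/fires_map: Hf; apply: fires_mono.
Qed.

(** Forwards, a smaller closed set for one state can be substituted into [S] without breaking the
    other states. Backwards, a smaller model agrees with [S] state by state, by induction along the
    path. *)
Lemma temporal_answer_setP S :
  partial_interpretation sigma S ->
  temporal_answer_set Pi sigma S <->
  forall h, state_stable (predecessor sigma (state_at S) h) (state_at S h).
Proof.
move=> piS; split=> [[[_ /sat_reductP modS] minS] h | H].
- split=> [|Y YS clY l Sl]; first by case: h (modS h) => [|h].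
  (* State [h] is replaced by [Y]; all other states are kept. *)
  pose S' : set (expression Sigma P) :=
    [set e | S e /\ (size e.1 = h -> Y e.2)]%classic.
  have S'S : (S' `<=` S)%classic by move=> e [].
  have S'h : state_at S' h = Y.
    rewrite eqEsubset; split=> m /=.
      by case=> _; apply; rewrite size_prefix_of.
    by move=> Ym; split=> //; apply: YS.
  have S'n h' : h' <> h -> state_at S' h' = state_at S h'.
    move=> nh; rewrite eqEsubset; split=> m /=; first by case.
    by move=> Sm; split=> //=; rewrite size_prefix_of.
  have eS'S : S' = S; last by move: Sl; rewrite -S'h eS'S.
  apply: (minS _ _ S'S); split.
    case: piS => pS cS; split=> [w m /S'S /pS // | w f [/S'S Sp /S'S Sn]].
    exact: cS (conj Sp Sn).
  have subS h' : (state_at S' h' `<=` state_at S h')%classic by move=> m /S'S.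
  case: clY => stY trY; apply/sat_reductP => h'; have [st tr] := modS h'.
  (* Apart from state [h], closed by the choice of [Y], the states are unchanged and at most their
     predecessor has shrunk. *)
  case: (pselect (h' = h)) => [eh | nh]; last first.
    rewrite S'n //; split=> //; case: h' {nh st} tr => [|h'] //.
    exact: step_closed_anti.
  rewrite eh S'h; split=> //.
  by case: (h) trY => [|i] //=; apply: step_closed_anti (subS i).
- split; first split=> //.
    by apply/sat_reductP => -[|h]; [apply: (H 0).1 | apply: (H h.+1).1].
  move=> S' [piS' /sat_reductP modS'] S'S.
  have eqS h : state_at S' h = state_at S h.
    elim: h => [|h IH]; rewrite eqEsubset; (split; first by move=> l /S'S).
    + by apply: (H 0).2 (modS' 0) => l /S'S.
    + apply: (H h.+1).2; first by move=> l /S'S.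
      (* Stability compares sets over the same predecessor, which the induction hypothesis
         supplies. *)
      by have := modS' h.+1; rewrite IH.
  rewrite eqEsubset; split=> // -[w l] Swl.
  have Ew : w = prefix_of sigma (size w) by case: piS => + _; apply; apply: Swl.
  move: Swl; rewrite Ew => Swl.
  by have : state_at S (size w) l by []; rewrite -eqS.
Qed.

End Temporal.

(** * Consistent answer sets of the program give stable states and a loop *)

Section Program.
Variable k : nat.
Implicit Types (R : set (literal (asp_atom Sigma P))) (sigma : nat -> Sigma).

Definition holds_in R s : set (literal P) :=
  [set l | R (holds_at Sigma s l)]%classic.

Lemma holds_at_inj s s' (l l' : literal P) :
  holds_at Sigma s l = holds_at Sigma s' l' -> s = s' /\ l = l'.
Proof. by case: l l' => f [] f' //= [-> ->]. Qed.

Lemma head_in_omap R s l0 :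
  head_in (holds_in R s) l0 <-> head_in R (omap (holds_at Sigma s) l0).
Proof. by case: l0. Qed.

Lemma fires_holds_at R R' s pos neg :
  fires R R' (map (holds_at Sigma s) pos) (map (holds_at Sigma s) neg) <->
  fires (holds_in R s) (holds_in R' s) pos neg.
Proof. exact: fires_map. Qed.

Lemma fires_step_at R R' s pos neg :
  fires R R' (map (step_at Sigma s) pos) (map (step_at Sigma s) neg) <->
  fires (step_sat (holds_in R s) (holds_in R s.+1))
    (step_sat (holds_in R' s) (holds_in R' s.+1)) pos neg.
Proof.
have E (X : set (literal (asp_atom Sigma P))) :
    (fun t => X (step_at Sigma s t)) =
    step_sat (holds_in X s) (holds_in X s.+1) by apply/funext => -[].
by rewrite -!E; apply: fires_map.
Qed.

Lemma asp_reduct_closedP Q R R' :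
  (forall r, asp_reduct Q R r -> (forall l, List.In l (asp_pos r) -> R' l) ->
     if asp_head r is Some l then R' l else False) <->
  (forall l0 pos neg, Q (AspRule l0 pos neg) -> fires R R' pos neg ->
     head_in R' l0).
Proof.
split=> [H l0 pos neg Qr [Hp Hn] | H _ [[l0 pos neg] [Qr /= Hn ->]] /= Hp].
  by apply: (H (AspRule _ _ [::])) Hp; exists (AspRule l0 pos neg).
exact: H Qr _.
Qed.

Lemma asp_answer_set_model R l0 pos neg :
  asp_answer_set (tr k Pi) R -> tr k Pi (AspRule l0 pos neg) ->
  fires R R pos neg -> head_in R l0.
Proof. by move=> [[/asp_reduct_closedP clR _] _]; apply: clR. Qed.

(* If no rule derives an element of [B] from literals outside [B], then [R]
   minus [B] is closed, hence equal to [R] by minimality. *)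
Lemma asp_answer_set_founded R B :
  asp_answer_set (tr k Pi) R -> consistent R ->
  (forall r l, tr k Pi r -> asp_head r = Some l ->
     fires R (R `\` B)%classic (asp_pos r) (asp_neg r) -> ~ B l) ->
  (R `<=` ~` B)%classic.
Proof.
move=> ansR conR H; case: (ansR) => _ minR.
suff <- : (R `\` B)%classic = R by move=> l [].
apply: minR => [|l []//]; split; last first.
  by left=> a [[Ra _] [Rb _]]; apply: conR (conj Ra Rb).
apply/asp_reduct_closedP => l0 pos neg Qr Hf.
have : fires R R pos neg by apply: fires_mono Hf => // l [].
move/(asp_answer_set_model ansR Qr).
by case: l0 Qr => [l|] //= Qr Rl; split=> //; apply: H Qr _ Hf.
Qed.

(** Otherwise [l] alone could be removed: foundedness is applied to a singleton. *)
Lemma asp_answer_set_supported R l :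
  asp_answer_set (tr k Pi) R -> consistent R -> R l ->
  exists r, [/\ tr k Pi r, asp_head r = Some l
              & fires R R (asp_pos r) (asp_neg r)].
Proof.
move=> ansR conR Rl; apply: contrapT => nsup.
apply: (asp_answer_set_founded (B := [set l]%classic) ansR conR _ Rl) => //.
move=> r l' Qr Er Hf ll'; apply: nsup; exists r; rewrite Er ll'; split=> //.
by apply: fires_mono Hf => // m [].
Qed.

(** Closure is read off the translated laws. For minimality, the literals of state [s] outside a
    smaller closed [Y] form an unfounded set: a rule firing without them fires in [Y], so its head
    lies in [Y]. *)
Lemma asp_answer_set_state_stable R (a : nat -> Sigma) s :
  asp_answer_set (tr k Pi) R -> consistent R ->
  (forall i, i <= k -> R (Pos (Occurs P (a i) i))) -> s <= k.+1 ->
  state_stable (predecessor a (holds_in R) s) (holds_in R s).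
Proof.
move=> ansR conR Ra sk.
have static_R : static_closed (holds_in R s) (holds_in R s).
  move=> l0 pos neg Hr Hf; apply/head_in_omap.
  by apply: (asp_answer_set_model ansR (tr_static_law Hr sk)); apply/fires_map.
split.
  split=> //; case: s sk {static_R} => [|s] sk.
    move=> l0 pos neg Hr Hf; apply/head_in_omap.
    apply: (asp_answer_set_model ansR (tr_initial_law k Hr)).
    exact/fires_map.
  move=> l0 pos neg Hr /fires_step_at [Hp Hn]; apply/head_in_omap.
  case: Hr => Hr.
    apply: asp_answer_set_model ansR (tr_action_law (s := s) Hr sk) _.
    by split=> // l /= [<-|/Hp//]; apply: Ra.
  exact: asp_answer_set_model ansR (tr_dynamic_law (s := s) Hr sk) _.
move=> Y YR [stY trY] l Rl; apply: contrapT => nYl.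
pose B : set (literal (asp_atom Sigma P)) :=
  [set m | exists2 l, m = holds_at Sigma s l & ~ Y l]%classic.
apply: (asp_answer_set_founded (B := B) ansR conR _ Rl); last by exists l.
have RBs : (holds_in (R `\` B) s `<=` Y)%classic.
  by move=> m [_ nB]; apply: contrapT => nYm; apply: nB; exists m.
have RBR i : (holds_in (R `\` B) i `<=` holds_in R i)%classic by move=> m [].
move=> r m Qr + + [l' El' nYl']; rewrite {}El' => Er Hf; apply: nYl'.
have head_l l0 s' : omap (holds_at Sigma s') l0 = Some (holds_at Sigma s l') ->
  s' = s /\ l0 = Some l' by case: l0 => // l0 [/holds_at_inj [-> ->]].
case: Qr Er Hf => //=; try by [case: (l')].
- move=> b l0 pos neg s' Hr s'k /head_l [es el0] [Hp Hn].
  subst s l0; apply: (trY (Some l') pos neg).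
    (* Two distinct actions at [s'] would make [R] inconsistent through the rule for
       [tr_not_occurs]. *)
    left; rewrite -(_ : b = a s') //.
    have Rb : R (Pos (Occurs P b s')) by have [] := Hp _ (or_introl erefl).
    apply: contrapT => nb; apply: conR (conj Rb _).
    apply: (asp_answer_set_model ansR (tr_not_occurs Pi s'k nb)).
    by split=> // _ /= [<-|//]; apply: Ra.
  have : fires R (R `\` B)%classic
      (map (step_at Sigma s') pos) (map (step_at Sigma s') neg).
    by split=> // t Ht; apply: Hp; right.
  move=> /fires_step_at; apply: fires_mono => // -[] u //=;
    by [apply: RBR | apply: RBs].
- move=> l0 pos neg s' Hr s'k /head_l [es el0] /fires_step_at Hf.
  subst s l0; apply: (trY (Some l') pos neg (or_intror Hr)).
  by apply: fires_mono Hf => // -[] u //=; [apply: RBR | apply: RBs].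
- move=> l0 pos neg s' Hr s'k /head_l [es el0] /fires_holds_at Hf.
  subst s l0; apply: (stY (Some l') pos neg Hr).
  exact: fires_mono Hf.
- move=> l0 pos neg Hr /head_l [es el0] /fires_holds_at Hf.
  subst s l0; apply: (trY (Some l') pos neg Hr).
  exact: fires_mono Hf.
Qed.

(** A negative [Occurs] literal can only be supported by another occurring action. If no action
    occurs, the default rule for [a0] therefore fires. *)
Lemma asp_answer_set_occurs R (a0 : Sigma) s :
  asp_answer_set (tr k Pi) R -> consistent R -> s <= k ->
  exists a, R (Pos (Occurs P a s)).
Proof.
move=> ansR conR sk; apply: contrapT => nocc.
have R0 : R (Pos (Occurs P a0 s)).
  apply: (asp_answer_set_model ansR (tr_occurs Pi a0 sk)).
  split=> // _ [<-|//] /(asp_answer_set_supported ansR conR) [r [Qr]].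
  case: Qr => //=; try by [case=> [[]|] | move=> ? [[]|]].
  by move=> b b' s' _ _ [_ ->] [Hp _]; case: nocc; exists b'; apply: Hp; left.
by case: nocc; exists a0.
Qed.

Lemma asp_answer_set_next R :
  asp_answer_set (tr k Pi) R -> consistent R ->
  exists2 j, j <= k & R (Pos (NextState Sigma P k j)).
Proof.
move=> ansR conR; apply: contrapT => nnext.
have R0 : R (Pos (NextState Sigma P k 0)).
  apply: (asp_answer_set_model ansR (tr_next_last Pi (leq0n k))).
  split=> // _ [<-|//] /(asp_answer_set_supported ansR conR) [r [Qr]].
  case: Qr => //=; try by [case=> [[]|] | move=> ? [[]|]].
  (* A supporter of the negative literal is some [NextState k j] with only [j <= k.+1] known. Its
     own support is the default rule, which gives [j <= k], since the facts [tr_next] start below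
     [k]. *)
  move=> i j _ jk _ _ [/(_ _ (or_introl erefl)) Rj _].
  case: nnext; exists j => //.
  case: (asp_answer_set_supported ansR conR Rj) => r' [Qr'].
  case: Qr' => //=; try by [case=> [[]|] | move=> ? [[]|]].
    by move=> i' + [ei _]; rewrite ei ltnn.
  by move=> i' + [<-].
by case: nnext; exists 0.
Qed.

(** The loop constraint forces [EqLast j], whose only rule requires the absence of [DiffLast j].
    Hence no fluent has opposite values at [j] and [k.+1], and totality turns this into equality. *)
Lemma asp_answer_set_loop R j :
  asp_answer_set (tr k Pi) R -> consistent R -> state_total k R ->
  j <= k -> R (Pos (NextState Sigma P k j)) ->
  holds_in R k.+1 = holds_in R j.
Proof.
move=> ansR conR totR jk Rj.
have Req : R (Pos (EqLast Sigma P j)).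
  apply: contrapT => neq.
  apply: (asp_answer_set_model ansR (tr_loop Pi (leqW jk))).
  by split=> _ /= [<-|//].
have ndiff : ~ R (Pos (DiffLast Sigma P j)).
  case: (asp_answer_set_supported ansR conR Req) => r [Qr].
  case: Qr => //=; try by [case=> [[]|] | move=> ? [[]|]].
  by move=> i _ [->] [_ Hn]; apply: Hn; left.
have same f : (R (Pos (Holds Sigma f k.+1)) <-> R (Pos (Holds Sigma f j))) /\
    (R (Neg (Holds Sigma f k.+1)) <-> R (Neg (Holds Sigma f j))).
  have pn : ~ (R (Pos (Holds Sigma f j)) /\ R (Neg (Holds Sigma f k.+1))).
    case=> Rp Rn; apply: ndiff.
    apply: (asp_answer_set_model ansR (tr_diff_last_pos Pi f jk)).
    by split=> // _ [<-|[<-|[]]].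
  have np : ~ (R (Pos (Holds Sigma f k.+1)) /\ R (Neg (Holds Sigma f j))).
    case=> Rp Rn; apply: ndiff.
    apply: (asp_answer_set_model ansR (tr_diff_last_neg Pi f jk)).
    by split=> // _ [<-|[<-|[]]].
  have c1 := conR (Holds Sigma f j); have c2 := conR (Holds Sigma f k.+1).
  have := totR f j (leqW jk); have := totR f k.+1 (leqnn _).
  tauto.
by rewrite eqEsubset; split=> -[] f /=; have [[? ?] [? ?]] := same f.
Qed.

(** * Stable paths with a loop give answer sets of the program *)

Definition loop_differs T s : Prop :=
  exists f, (T s (Pos f) /\ T k.+1 (Neg f)) \/ (T k.+1 (Pos f) /\ T s (Neg f)).

(** The intended answer set in closed form: the first [k.+1] actions of [sigma], the states of [T]
    up to [k.+1], the back edge from [k] to [j], and the auxiliary literals these determine. *)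
Definition path_answer_set sigma T j : set (literal (asp_atom Sigma P)) :=
  fun l => match l with
  | Pos (State s) => s <= k.+1
  | Pos (Action _) | Pos (Fluent _) => True
  | Pos (Holds f s) => s <= k.+1 /\ T s (Pos f)
  | Neg (Holds f s) => s <= k.+1 /\ T s (Neg f)
  | Pos (Occurs a s) => s <= k /\ a = sigma s
  | Neg (Occurs a s) => s <= k /\ a <> sigma s
  | Pos (NextState s s') => (s < k /\ s' = s.+1) \/ (s = k /\ s' = j)
  | Neg (NextState s s') => [/\ s = k, s' <= k.+1 & s' <> j]
  | Pos (DiffLast s) => s <= k /\ loop_differs T s
  | Pos (EqLast s) => s <= k /\ ~ loop_differs T s
  | _ => False
  end.

Lemma path_answer_set_holds sigma T j s :
  s <= k.+1 -> holds_in (path_answer_set sigma T j) s = T s.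
Proof.
by move=> sk; rewrite eqEsubset; split=> -[] f /=; [case | case | |].
Qed.

Lemma path_answer_set_consistent sigma T j :
  (forall s f, ~ (T s (Pos f) /\ T s (Neg f))) ->
  consistent (path_answer_set sigma T j).
Proof.
move=> conT; case=> [x|x|x|f s|a s|s s'|x|x] /= [] //.
- by move=> [_ p] [_ n]; apply: conT (conj p n).
- by move=> [_ ->] [].
- by case=> [[sk ->] [ek]|[_ ->] []//]; rewrite ek ltnn in sk.
Qed.

Lemma path_answer_set_model sigma T j :
  (forall s f, ~ (T s (Pos f) /\ T s (Neg f))) ->
  (forall s, s <= k.+1 -> state_stable (predecessor sigma T s) (T s)) ->
  j <= k -> T k.+1 = T j ->
  forall l0 pos neg, tr k Pi (AspRule l0 pos neg) ->
    fires (path_answer_set sigma T j) (path_answer_set sigma T j) pos neg ->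
    head_in (path_answer_set sigma T j) l0.
Proof.
move=> conT stT jk loopT l0 pos neg.
set R := path_answer_set sigma T j.
have TR s : s <= k.+1 -> holds_in R s = T s by apply: path_answer_set_holds.
move Er: (AspRule l0 pos neg) => r Qr.
case: Qr Er => /=.
- by move=> s sk [-> _ _] _.
- by move=> a [-> _ _].
- by move=> f [-> _ _].
- move=> a a1 s sk na [-> -> _] [/(_ _ (or_introl erefl)) /= [_ ea] _].
  by split=> // ea1; apply: na; rewrite ea ea1.
- move=> a s sk [-> _ ->] [_ /(_ _ (or_introl erefl)) /= H]; split=> //.
  by apply: contrapT => na; apply: H.
- move=> a l1 pos1 neg1 s Hr sk [-> -> ->] [Hp Hn].
  have [_ ea] := Hp _ (or_introl erefl); subst a.
  apply/head_in_omap; rewrite TR //.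
  apply: (stT s.+1 sk).1.2 (or_introl Hr) _; rewrite -!TR //; last exact: leqW.
  by apply/fires_step_at; split=> // t Ht; apply: Hp; right.
- move=> l1 pos1 neg1 s Hr sk [-> -> ->] Hf.
  apply/head_in_omap; rewrite TR //.
  apply: (stT s.+1 sk).1.2 (or_intror Hr) _; rewrite -!TR //; last exact: leqW.
  by apply/fires_step_at.
- move=> l1 pos1 neg1 s Hr sk [-> -> ->] Hf.
  apply/head_in_omap; rewrite TR //.
  apply: (stT s sk).1.1 Hr _; rewrite -!TR //; exact/fires_holds_at.
- move=> l1 pos1 neg1 Hr [-> -> ->] Hf.
  apply/head_in_omap; rewrite TR //.
  apply: (stT 0 (leq0n _)).1.2 Hr _; rewrite -!TR //; exact/fires_holds_at.
- move=> f s sk [-> -> _] [Hp _]; split=> //; exists f; left.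
  by have [] := Hp _ (or_introl erefl);
    have [] := Hp _ (or_intror (or_introl erefl)).
- move=> f s sk [-> -> _] [Hp _]; split=> //; exists f; right.
  by have [] := Hp _ (or_introl erefl);
    have [] := Hp _ (or_intror (or_introl erefl)).
- move=> s sk [-> _ ->] [_ /(_ _ (or_introl erefl)) H]; split=> // D.
  exact: H.
- by move=> s sk [-> _ _]; left.
- move=> s s' sk sk' ns [-> -> _] [/(_ _ (or_introl erefl)) + _] /=.
  case=> [[]|[_ ej]]; first by rewrite ltnn.
  by split=> // es; apply: ns; rewrite ej.
- move=> s sk [-> _ ->] [_ /(_ _ (or_introl erefl)) /= H]; right; split=> //.
  by apply: contrapT => ns; apply: H; split=> //; apply: leqW.
- move=> s sk [-> -> ->] [/(_ _ (or_introl erefl)) /= Hs Hn].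
  case: Hs => [[]|[_ ej]]; first by rewrite ltnn.
  (* As [T k.+1 = T j], a difference at [j] would be a contradiction inside one state, so [EqLast j]
     holds and the constraint is not violated. *)
  apply: Hn (or_introl erefl) _; rewrite ej; split=> // -[f].
  by rewrite loopT => -[[? ?]|[? ?]]; apply: (conT j f).
Qed.

(** A closed subset recovers everything in order: the actions by default, then the states by
    induction and stability, then the back edge and the auxiliary literals. *)
Lemma path_answer_set_minimal sigma T j R' :
  (forall s, s <= k.+1 -> state_stable (predecessor sigma T s) (T s)) ->
  j <= k ->
  (forall l0 pos neg, tr k Pi (AspRule l0 pos neg) ->
    fires (path_answer_set sigma T j) R' pos neg -> head_in R' l0) ->
  (R' `<=` path_answer_set sigma T j)%classic ->
  (path_answer_set sigma T j `<=` R')%classic.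
Proof.
set R := path_answer_set sigma T j.
move=> stT jk clR' R'R.
have TR s : s <= k.+1 -> holds_in R s = T s by apply: path_answer_set_holds.
have occR s : s <= k -> R' (Pos (Occurs P (sigma s) s)).
  move=> sk; apply: (clR' _ _ _ (tr_occurs Pi (sigma s) sk)).
  by split=> // _ [<-|//] [].
have TR' s : s <= k.+1 -> holds_in R' s = T s.
  elim: s => [|s IH] sk; rewrite eqEsubset.
    split; first by rewrite -(TR _ sk) => l; apply: R'R.
    apply: (stT 0 sk).2; first by rewrite -(TR _ sk) => l; apply: R'R.
    split=> l1 pos neg Hr Hf; apply/head_in_omap.
      apply: (clR' _ _ _ (tr_static_law Hr sk)).
      by apply/fires_holds_at; rewrite TR.
    apply: (clR' _ _ _ (tr_initial_law k Hr)).
    by apply/fires_holds_at; rewrite TR.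
  split; first by rewrite -(TR _ sk) => l; apply: R'R.
  apply: (stT _ sk).2; first by rewrite -(TR _ sk) => l; apply: R'R.
  split=> l1 pos neg Hr Hf; apply/head_in_omap.
    apply: (clR' _ _ _ (tr_static_law Hr sk)).
    by apply/fires_holds_at; rewrite TR.
  have [Hp Hn] : fires R R' (map (step_at Sigma s) pos)
      (map (step_at Sigma s) neg).
    (* By induction [R'] already has the full state [s], so the body fires in the program as
       well. *)
    by apply/fires_step_at; rewrite IH ?TR //; apply: ltnW.
  case: Hr => Hr.
    apply: (clR' _ _ _ (tr_action_law (s := s) Hr sk)).
    by split=> // l /= [<-|/Hp//]; apply: occR.
  exact: (clR' _ _ _ (tr_dynamic_law (s := s) Hr sk)).
have R'pos f s : s <= k.+1 -> T s (Pos f) -> R' (Pos (Holds Sigma f s)).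
  by move=> sk; rewrite -TR'.
have R'neg f s : s <= k.+1 -> T s (Neg f) -> R' (Neg (Holds Sigma f s)).
  by move=> sk; rewrite -TR'.
have nextR' : R' (Pos (NextState Sigma P k j)).
  apply: (clR' _ _ _ (tr_next_last Pi jk)).
  by split=> // _ [<-|//] [].
case=> -[s|a|f|f s|a s|s s'|s|s] //=.
- by move=> sk; apply: (clR' _ _ _ (tr_state Pi sk)); split.
- by move=> _; apply: (clR' _ _ _ (tr_action k Pi a)); split.
- by move=> _; apply: (clR' _ _ _ (tr_fluent k Pi f)); split.
- by case; apply: R'pos.
- by case=> sk ->; apply: occR.
- case=> [[sk ->]|[-> ->]//].
  by apply: (clR' _ _ _ (tr_next Pi sk)); split.
- case=> sk [f [] [? ?]].
  + apply: (clR' _ _ _ (tr_diff_last_pos Pi f sk)); split=> // _ [<-|[<-|[]]].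
      by apply: R'pos => //; apply: leqW.
    exact: R'neg.
  + apply: (clR' _ _ _ (tr_diff_last_neg Pi f sk)); split=> // _ [<-|[<-|[]]].
      exact: R'pos.
    by apply: R'neg => //; apply: leqW.
- case=> sk nd; apply: (clR' _ _ _ (tr_eq_last Pi sk)); split=> // _ [<-|//].
  by case.
- by case; apply: R'neg.
- case=> sk na; apply: (clR' _ _ _ (tr_not_occurs Pi sk na)).
  by split=> // _ [<-|//]; apply: occR.
- case=> -> sk nj; apply: (clR' _ _ _ (tr_not_next_last Pi sk (leqW jk) nj)).
  by split=> // _ [<-|//].
Qed.

Lemma path_answer_setP sigma T j :
  (forall s f, ~ (T s (Pos f) /\ T s (Neg f))) ->
  (forall s, s <= k.+1 -> state_stable (predecessor sigma T s) (T s)) ->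
  j <= k -> T k.+1 = T j ->
  asp_answer_set (tr k Pi) (path_answer_set sigma T j).
Proof.
move=> conT stT jk loopT; split.
  split; last by left; apply: path_answer_set_consistent.
  by apply/asp_reduct_closedP/path_answer_set_model.
move=> R' [/asp_reduct_closedP clR' _] R'R; rewrite eqEsubset; split=> //.
exact: path_answer_set_minimal clR' R'R.
Qed.

End Program.
End LocalStability.

(** * Arithmetic of positions on a loop *)

Lemma loop_position_small j k h : h <= k -> loop_position j k h = h.
Proof.
rewrite /loop_position; case: ltnP => // jh hk.
by rewrite modn_small ?subnKC // ltn_sub2r // ltnS (leq_trans jh).
Qed.

Lemma loop_position_last j k : j <= k -> loop_position j k k.+1 = j.
Proof.
by move=> jk; rewrite /loop_position ltnNge leqW //= modnn addn0.
Qed.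

Lemma loop_position_le j k h : j <= k -> loop_position j k h <= k.
Proof.
rewrite /loop_position => jk; case: ltnP => hj.
  exact: leq_trans (ltnW hj) jk.
have := ltn_pmod (h - j) (_ : 0 < k.+1 - j); rewrite subn_gt0 ltnS => /(_ jk).
by rewrite ltn_subRL ltnS.
Qed.

(** The modular formula is a walk that steps forward and jumps from [k] to [j], because [k] has the
    last residue modulo the loop length [k.+1 - j]. *)
Lemma loop_positionS j k h : j <= k ->
  loop_position j k h.+1 =
  if loop_position j k h == k then j else (loop_position j k h).+1.
Proof.
move=> jk; rewrite /loop_position; case: (ltnP h j) => hj.
  rewrite (ltn_eqF (leq_trans hj jk)).
  case: ltnP => // jh; have -> : h.+1 = j by apply/eqP; rewrite eqn_leq hj.
  by rewrite subnn mod0n addn0.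
rewrite ltnNge leqW //= subSn //.
have := ltn_pmod (h - j) (_ : 0 < k.+1 - j); rewrite subn_gt0 ltnS => /(_ jk).
rewrite -[(h - j).+1]addn1 -modnDml addn1; move: (_ %% _) => r small.
have -> : (j + r == k) = (r.+1 == k.+1 - j).
  by rewrite -[in RHS](eqn_add2l j) addnS subnKC ?eqSS // leqW.
case: eqP => [->|neq]; first by rewrite modnn addn0.
by rewrite modn_small ?addnS // ltn_neqAle small andbT; apply/eqP.
Qed.

Theorem theorem1 (Sigma : finType) (P : Type) (Pi : set (law Sigma P))
    (Sigma_nonempty : 0 < #|Sigma|)
    (Pi_initial : initially_completed Pi)
    (Pi_well_defined : well_defined Pi)
    (k : nat) :
  (forall (sigma : nat -> Sigma) (S : set (expression Sigma P)) (j : nat),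
      temporal_answer_set Pi sigma S ->
      j <= k ->
      model_with_loop j k (model_of_interpretation sigma S) ->
      exists R : set (literal (asp_atom Sigma P)),
        [/\ asp_answer_set (tr k Pi) R,
            consistent R
          & is_model_of_answer_set k R (model_of_interpretation sigma S)])
  /\
  (forall R : set (literal (asp_atom Sigma P)),
      asp_answer_set (tr k Pi) R ->
      consistent R ->
      state_total k R ->
      exists (sigma : nat -> Sigma) (S : set (expression Sigma P)),
        [/\ temporal_answer_set Pi sigma S,
            (exists2 j : nat, j <= k &
               model_with_loop j k (model_of_interpretation sigma S))
          & is_model_of_answer_set k R (model_of_interpretation sigma S)]).
Proof.
split.
- move=> sigma S j ansS jk [pathS valS].
  have piS : partial_interpretation sigma S by case: ansS => -[].
  have stS := (temporal_answer_setP Pi piS).1 ansS.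
  have totS := Pi_well_defined sigma S ansS.
  have conS s f : ~ (state_at sigma S s (Pos f) /\ state_at sigma S s (Neg f)).
    by case: piS => _; apply.
  (* The looping valuation speaks of positive literals only; totality, from well-definedness,
     determines the negative ones. *)
  have loopS : state_at sigma S k.+1 = state_at sigma S j.
    have posS f :
        S (prefix_of sigma k.+1, Pos f) = S (prefix_of sigma j, Pos f).
      have := congr1 (@^~ f) (valS k.+1); rewrite loop_position_last //.
    have negS f s :
        S (prefix_of sigma s, Neg f) = ~ S (prefix_of sigma s, Pos f).
      apply/propext; split=> [Sn Sp|nSp]; first exact: conS (conj Sp Sn).
      by case: (totS s f).
    rewrite eqEsubset; split=> -[] f; rewrite /state_at /=.
    + by rewrite posS.
    + by rewrite !negS posS.
    + by rewrite posS.
    + by rewrite !negS posS.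
  exists (path_answer_set k sigma (state_at sigma S) j); split.
  + exact: path_answer_setP.
  + exact: path_answer_set_consistent.
  + exists j, sigma; split=> //=; first by right.
    rewrite /model_of_interpretation /model_of_answer_set; congr TemporalModel.
      exact/funext.
    apply/funext => h; rewrite eqEsubset.
    have vh := valS h; rewrite /= in vh; rewrite vh.
    have lk := leqW (loop_position_le h jk).
    by split=> p /= => [|[]].
- move=> R ansR conR totR.
  have /card_gt0P [a0 _] := Sigma_nonempty.
  (* Beyond [k] the chosen action is the dummy [a0]. *)
  have /choice [a aR] : forall i, exists a, i <= k -> R (Pos (Occurs P a i)).
    move=> i; case: (leqP i k) => [ik|_]; last by exists a0.
    by have [a Ra] := asp_answer_set_occurs a0 ansR conR ik; exists a.
  have [j jk Rj] := asp_answer_set_next ansR conR.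
  have loopR := asp_answer_set_loop ansR conR totR jk Rj.
  (* The program's path is unrolled around its loop. Step [k.+1] reuses state [j], so the program's
     state [k.+1] does not appear in [T]. *)
  pose sigma h := a (loop_position j k h).
  pose T h := holds_in R (loop_position j k h).
  pose S : set (expression Sigma P) :=
    [set e | e.1 = prefix_of sigma (size e.1) /\ T (size e.1) e.2]%classic.
  have TS : state_at sigma S = T.
    apply/funext => h; rewrite eqEsubset.
    by split=> l /=; rewrite /state_at /S /= size_prefix_of => // -[].
  have piS : partial_interpretation sigma S.
    split=> [w l [] //|w f [[_ Rp] [_ Rn]]]; exact: conR (conj Rp Rn).
  have lpK h : loop_position j k (loop_position j k h) = loop_position j k h.
    exact/loop_position_small/loop_position_le.
  have valS h : [set p | S (prefix_of sigma h, Pos p)]%classic =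
      [set p | R (Pos (Holds Sigma p (loop_position j k h)))]%classic.
    by apply/funext => p; apply: (congr1 (fun U => U h (Pos p)) TS).
  exists sigma, S; split.
  + apply/temporal_answer_setP => // h; rewrite TS.
    have st s := asp_answer_set_state_stable (s := s) ansR conR aR.
    case: h => [|h].
      by have := st 0 (leq0n _); rewrite /T /= loop_position_small.
    (* Each unrolled transition copies one of the program. At the back edge that one ends in state
       [k.+1], which [loopR] identifies with state [j]. *)
    have := st (loop_position j k h).+1 (loop_position_le h jk).
    rewrite /= /T /sigma loop_positionS //.
    by case: eqP => // ->; rewrite loopR.
  + exists j => //; split=> h /=; first by rewrite /sigma lpK.
    by rewrite !valS lpK.
  + exists j, a; split=> //.
    by congr TemporalModel; apply/funext => h; apply: valS.
Qed.
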